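(* (1) For every subset $T'\subseteq S$ and every $n>4$, $\langle S_n(\{123,321\}\cup T')\rangle=\{\mathrm{id}_n\}$. (2) $\langle S_n(213,231,312,321)\rangle\cong\langle S_n(132,231,312,321)\rangle\cong\langle S_n(132,213,231,312)\rangle\cong\mathbb{Z}_2$. (3) $\langle S_n(123,132,213,231)\rangle\cong\langle S_n(123,132,213,312)\rangle\cong D_4$. (4) $\langle S_n(132,213,312,321)\rangle\cong\langle S_n(132,213,231,321)\rangle\cong\mathbb{Z}_n$. (5) $\langle S_n(123,213,231,312)\rangle\cong\langle S_n(123,132,231,312)\rangle\cong D_n$. (6) $\langle S_n(123,132,213,231,312)\rangle\cong\mathbb{Z}_2$. (7) $\langle S_n(132,213,231,312,321)\rangle=\{\mathrm{id}_n\}$. Items (2)–(7) hold for all sufficiently large $n$.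
   Context: $S_n$ is the symmetric group on $[n]$, permutations in one-line notation, $S=\bigcup_{n\ge0}S_n$, $\mathrm{id}_n=12\cdots n$. A permutation $\pi\in S_n$ contains the pattern $\tau\in S_k$ if some subsequence of $\pi$ of length $k$ is order-isomorphic to $\tau$; otherwise it avoids $\tau$. $S_n(T)$ (also written $S_n(\tau_1,\dots,\tau_j)$ for $T=\{\tau_1,\dots,\tau_j\}$) is the set of permutations in $S_n$ avoiding every pattern in $T$, and $\langle A\rangle$ is the subgroup of $S_n$ generated by $A$. $\mathbb{Z}_m$ is the cyclic group of order $m$ and $D_m$ the dihedral group of order $2m$. *)

(* Defs.v *)
From mathcomp Require Import all_boot perm fingroup morphism zmodp extremal.
From mathcomp Require Import boolp classical_sets.

Set Implicit Arguments.
Unset Strict Implicit.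
Unset Printing Implicit Defensive.

(* The set S, the disjoint union of all the symmetric groups S_k, k >= 0. *)
Definition permutation : Type := {k : nat & 'S_k}.

(* One-line notation with letters 1, ..., n, although 'I_n starts at 0. *)
Definition one_line n (p : 'S_n) : seq nat := [seq (p i : nat).+1 | i : 'I_n].

(* The permutation with one-line notation w; a junk value (the identity) when
   w is not a rearrangement of 1, ..., size w; see one_lineK. *)
Definition of_word (w : seq nat) : permutation :=
  existT (fun k => 'S_k) (size w)
    (odflt 1%g [pick p : 'S_(size w) | one_line p == w]).

Definition contains n (p : 'S_n) k (t : 'S_k) : Prop :=
  exists f : 'I_k -> 'I_n,
    (forall i j : 'I_k, i < j -> f i < f j) /\
    (forall i j : 'I_k, (p (f i) < p (f j)) = (t i < t j)).

Definition Av n (T : set permutation) : {set 'S_n} :=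
  finset (fun p : 'S_n =>
    `[< forall t : permutation, T t -> ~ contains p (projT2 t) >]).

Definition p123 : permutation := of_word [:: 1; 2; 3].
Definition p132 : permutation := of_word [:: 1; 3; 2].
Definition p213 : permutation := of_word [:: 2; 1; 3].
Definition p231 : permutation := of_word [:: 2; 3; 1].
Definition p312 : permutation := of_word [:: 3; 1; 2].
Definition p321 : permutation := of_word [:: 3; 2; 1].

Lemma one_lineK (w : seq nat) :
  perm_eq w (iota 1 (size w)) -> one_line (projT2 (of_word w)) = w.
Proof.
move=> pw; rewrite /of_word /=; case: pickP => [p /eqP //|noP].
have wb i : i < size w -> 0 < nth 0 w i <= size w.
  by move=> /(mem_nth 0); rewrite (perm_mem pw) mem_iota add1n ltnS.
have ub (i : 'I_(size w)) : (nth 0 w i).-1 < size w.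
  by have /andP[w0 wn] := wb i (ltn_ord i); rewrite prednK.
have uw : uniq w by rewrite (perm_uniq pw) iota_uniq.
pose f i := Ordinal (ub i).
have injf : injective f.
  move=> i j /(congr1 val)/= e; apply/val_inj/eqP.
  rewrite -(nth_uniq 0 _ _ uw) ?ltn_ord //.
  have /andP[wi _] := wb i (ltn_ord i); have /andP[wj _] := wb j (ltn_ord j).
  by rewrite -(prednK wi) -(prednK wj) e.
suff e : one_line (perm injf) = w by have := noP (perm injf); rewrite e eqxx.
have sz : size (one_line (perm injf)) = size w by rewrite size_image card_ord.
apply: (@eq_from_nth _ 0) => //; rewrite sz => i lti.
rewrite (nth_map (Ordinal lti)) ?size_enum_ord // permE /=.
by rewrite nth_enum_ord // prednK //; case/andP: (wb i lti).
Qed.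

(* Main.v *)
(* For i < j < k, the pattern of p at (i, j, k) is determined by which of the
   three pairs of positions are inversions.  In (2)-(7) the allowed patterns are
   123 and t, or, after replacing every value by its complement, 321 and the
   complement of t.  This forces the inversion set of p to be either empty or one
   fixed set, so the avoiders are either 1 and q, or w and q w, where w is the
   reversal and q is an adjacent transposition at one end, a cyclic shift, w or 1.
   In (3) and (5), w together with q or q w is a pair of involutions generating
   a dihedral group, because w inverts the shift and exchanges the first and the
   last adjacent transposition.
   In (1), for i < j < k exactly one of the pairs (i, j), (j, k) is an
   inversion, which is impossible on five positions. *)
Require Import Defs.
From mathcomp Require Import all_boot perm fingroup morphism zmodp extremal.
From mathcomp Require Import boolp classical_sets.
From mathcomp Require Import cyclic zify.

Local Open Scope classical_set_scope.
Local Open Scope group_scope.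

(** * Inversion triples and avoidance of patterns of length three *)

Definition inversions n (p : 'S_n) (i j k : 'I_n) : bool * bool * bool :=
  ((p j < p i)%N, (p k < p j)%N, (p k < p i)%N).

Lemma ltn_perm n (p : 'S_n) (i j : 'I_n) :
  (i < j)%N -> (p i < p j)%N = ~~ (p j < p i)%N.
Proof.
move=> ij; rewrite -leqNgt ltn_neqAle; suff -> : (p i != p j :> nat) by [].
by apply/eqP => /val_inj /perm_inj e; rewrite e ltnn in ij.
Qed.

Definition avoiders n (ts : seq (bool * bool * bool)) : {set 'S_n} :=
  [set p : 'S_n | [forall i : 'I_n, forall j : 'I_n, forall k : 'I_n,
     (i < j < k)%N ==> (inversions n p i j k \notin ts)]]%SET.

Lemma avoidersP n ts (p : 'S_n) :
  reflect (forall i j k : 'I_n, (i < j)%N -> (j < k)%N ->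
             inversions n p i j k \notin ts)
          (p \in avoiders n ts).
Proof.
rewrite inE; apply: (iffP idP) => [H i j k ij jk | H].
  by have /forallP/(_ j)/forallP/(_ k)/implyP := forallP H i; apply; rewrite ij.
apply/forallP => i; apply/forallP => j; apply/forallP => k.
by apply/implyP => /andP[]; apply: H.
Qed.

Lemma avoidersI n ts us :
  (avoiders n ts :&: avoiders n us)%SET = avoiders n (ts ++ us).
Proof.
apply/setP => p; rewrite finset.in_setI.
apply/andP/avoidersP => [[/avoidersP P /avoidersP Q] i j k ij jk | H].
  by rewrite mem_cat negb_or P // Q.
by split; apply/avoidersP => i j k ij jk;
  have := H i j k ij jk; rewrite mem_cat negb_or => /andP[].
Qed.

(** Three distinct letters are ordered by their pairwise comparisons, so an occurrence at
    [i < j < k] amounts to equality of inversion triples. *)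
Lemma Av_word3 n (a b c : nat) :
  perm_eq [:: a; b; c] (iota 1 3) ->
  Av n [set of_word [:: a; b; c]] =
  avoiders n [:: ((b < a)%N, (c < b)%N, (c < a)%N)].
Proof.
move=> pw; have u : uniq [:: a; b; c] by rewrite (perm_uniq pw).
apply/setP => p.
have {pw} := one_lineK pw; rewrite inE; set q := projT2 _ => ow.
pose w i := nth 0%N [:: a; b; c] i.
(* Letters start at 1 and values of [q] at 0; the shift preserves comparisons. *)
have qE (x : 'I_3) : (q x).+1 = w x.
  have := congr1 (nth 0%N ^~ x) ow.
  by rewrite /one_line (nth_map x) ?size_enum_ord // nth_ord_enum.
have qlt x y : (q x < q y)%N = (w x < w y)%N by rewrite -!qE ltnS.
apply/asboolP/avoidersP => [avp i j k ij jk | avp].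
  rewrite inE; apply/negP => /eqP[e1 e2 e3]; apply: (avp _ erefl).
  have ik := ltn_trans ij jk.
  exists (fun x : 'I_3 => nth i [:: i; j; k] x); split.
    by move=> [[|[|[|x]]] hx] [[|[|[|y]]] hy].
  have /and3P[ab ac bc] : [&& a != b, a != c & b != c].
    by move: u; rewrite /= !inE !andbT negb_or -andbA.
  move=> x y; rewrite qlt; move: x y.
  move=> [[|[|[|x]]] hx] [[|[|[|y]]] hy] //; rewrite /w /= ?ltnn //;
    move: (ltn_perm _ p _ _ ij) (ltn_perm _ p _ _ jk) (ltn_perm _ p _ _ ik);
    lia.
move=> _ -> [f [fS fE]].
have fE' x y : (p (f x) < p (f y))%N = (w x < w y)%N by rewrite fE qlt.
pose x k (h : (k < 3)%N) : 'I_3 := Ordinal h.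
have /negP[] := avp (f (x 0%N isT)) (f (x 1%N isT)) (f (x 2%N isT))
  (fS (x 0%N isT) (x 1%N isT) isT) (fS (x 1%N isT) (x 2%N isT) isT).
by rewrite inE /inversions !fE'.
Qed.

Lemma Av_setU n (A B : set permutation) :
  Av n (A `|` B)%classic = (Av n A :&: Av n B)%SET.
Proof.
apply/setP => p; rewrite !inE; apply/asboolP/andP.
  by move=> h; split; apply/asboolP => t ?; apply: h; [left | right].
by move=> [/asboolP hA /asboolP hB] t [/hA | /hB].
Qed.

(** With equal inversions, [p^-1 * q] and [q^-1 * p] are increasing; an increasing self-map never
    lowers a point, which gives both inequalities between [p i] and [q i]. *)
Lemma perm_eq_inversions n (p q : 'S_n) :
  (forall i j : 'I_n, (i < j)%N -> (p j < p i)%N = (q j < q i)%N) -> p = q.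
Proof.
move=> H.
have mono (r : 'S_n) : (forall i j : 'I_n, (i < j)%N -> (r i < r j)%N) ->
    forall k : 'I_n, (k <= r k)%N.
  move=> inc [k hk]; elim: k hk => [|k IH] hk //=.
  exact: leq_ltn_trans (IH (ltnW hk)) (inc (Ordinal (ltnW hk)) (Ordinal hk) (ltnSn k)).
have dom (r s : 'S_n) :
    (forall i j : 'I_n, (i < j)%N -> (r j < r i)%N = (s j < s i)%N) ->
    forall i, (r i <= s i)%N.
  move=> rs i; have := mono (r^-1 * s) _ (r i); rewrite permM permK; apply.
  move=> x y xy; rewrite !permM.
  case: (ltngtP (r^-1 x) (r^-1 y)) => [lt|lt|/val_inj/perm_inj e].
  - by rewrite (ltn_perm _ _ _ _ lt) -(rs _ _ lt) !permKV -leqNgt ltnW.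
  - by rewrite -(rs _ _ lt) !permKV.
  - by rewrite e ltnn in xy.
apply/permP => i; apply/val_inj/eqP; rewrite eqn_leq !dom // => *.
by rewrite H.
Qed.

Lemma Av_patterns n :
  (Av n [set p123] = avoiders n [:: (false, false, false)]) *
  (Av n [set p132] = avoiders n [:: (false, true, false)]) *
  (Av n [set p213] = avoiders n [:: (true, false, false)]) *
  (Av n [set p231] = avoiders n [:: (false, true, true)]) *
  (Av n [set p312] = avoiders n [:: (true, false, true)]) *
  (Av n [set p321] = avoiders n [:: (true, true, true)]).
Proof. by do !split; apply: Av_word3. Qed.

(* The inversion triples of the patterns 123, 132, 213, 231, 312, 321. *)
Definition patterns3 : seq (bool * bool * bool) :=
  [:: (false, false, false); (false, true, false); (true, false, false);
      (false, true, true); (true, false, true); (true, true, true)].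

(** Transitivity of the order excludes [(false, false, true)] and [(true, true, false)]. *)
Lemma inversions_patterns3 n (p : 'S_n) (i j k : 'I_n) :
  (i < j)%N -> (j < k)%N -> inversions n p i j k \in patterns3.
Proof.
move=> ij jk; have ik := ltn_trans ij jk.
rewrite /inversions !inE !xpair_eqE.
move: (ltn_perm _ p _ _ ij) (ltn_perm _ p _ _ jk) (ltn_perm _ p _ _ ik); lia.
Qed.

(* [d] stands for the inversion relation of a permutation, or its negation. *)
Definition two_types (t : bool * bool * bool) n (d : 'I_n -> 'I_n -> bool) :=
  forall i j k : 'I_n, (i < j)%N -> (j < k)%N ->
    ((d i j, d j k, d i k) == (false, false, false)) ||
    ((d i j, d j k, d i k) == t).

(** * Complementing values, and sets of two avoiders *)

Definition revp n : 'S_n := perm (@rev_ord_inj n).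

(** Products apply the left factor first, so a right factor [revp n] complements values and toggles
    every inversion. *)
Lemma revp_expE n (e : bool) (p : 'S_n) (i j : 'I_n) : (i < j)%N ->
  ((p * revp n ^+ e)%g j < (p * revp n ^+ e)%g i)%N = (p j < p i)%N (+) e.
Proof.
move=> ij; case: e; last by rewrite mulg1 addbF.
rewrite addbT -(ltn_perm _ _ _ _ ij) expg1 !permM !permE /=.
have := ltn_ord (p i); have := ltn_ord (p j); lia.
Qed.

Definition supported (s : nat -> nat -> bool) n (d : 'I_n -> 'I_n -> bool) :=
  exists b, forall i j : 'I_n, (i < j)%N -> d i j = b && s i j.

Definition flip_type (e : bool) (x : bool * bool * bool) :=
  (x.1.1 (+) e, x.1.2 (+) e, x.2 (+) e).

(** The patterns outside [ts] must be 123 and [t], complemented when [e] holds; for a concrete list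
    this is settled by computation. *)
Definition allowed_up_to_flip (ts : seq (bool * bool * bool)) (e : bool) t : bool :=
  all (fun x => (x \notin ts) ==
                (flip_type e x \in [:: (false, false, false); t])) patterns3.

Lemma avoiders_pair n ts (e : bool) t s (q : 'S_n) :
  allowed_up_to_flip ts e t ->
  (forall d, two_types t n d <-> supported s n d) ->
  (forall i j : 'I_n, (i < j)%N -> (q j < q i)%N = s i j) ->
  avoiders n ts = [set revp n ^+ e; q * revp n ^+ e]%SET.
Proof.
move=> /allP tsP shape qs; apply/setP => p; rewrite in_set2.
have {tsP} tsP : p \in avoiders n ts <->
    two_types t n (fun i j => (p j < p i)%N (+) e).
  split=> [/avoidersP H | H].
    move=> i j k ij jk; have := tsP _ (inversions_patterns3 n p i j k ij jk).
    by rewrite H // !inE => /eqP <-.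
  apply/avoidersP => i j k ij jk.
  have := tsP _ (inversions_patterns3 n p i j k ij jk).
  by rewrite !inE H // => /eqP ->.
apply/idP/idP => [/tsP/shape[b pb] | pE].
  (* The bit [b] tells whether the toggled inversions of [p] are all of [s] or none; inversions then
     determine [p]. *)
  suff -> : p = (if b then q else 1) * revp n ^+ e.
    by case: b {pb}; rewrite ?mul1g eqxx ?orbT.
  apply: perm_eq_inversions => i j ij; rewrite revp_expE //; have := pb i j ij.
  case: b {pb} => [|] /=.
    by rewrite qs // => <-; rewrite -addbA addbb addbF.
  rewrite !permE [(j < i)%N]ltnNge (ltnW ij) /=.
  by case: (_ < _)%N; case: (e).
apply/tsP/shape; move: pE; rewrite -{1}[_ ^+ _]mul1g.
case/pred2P => ->; [exists false | exists true] => i j ij;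
  rewrite revp_expE // -addbA addbb addbF ?qs //.
by rewrite !permE [(j < i)%N]ltnNge (ltnW ij).
Qed.

(** * Relations whose triples take at most two values *)

(** A related pair is never the first or the outer pair of a triple, so no position lies after it or
    inside it: it consists of the last two positions. *)
Lemma two_types132 n (d : 'I_n -> 'I_n -> bool) : (2 < n)%N ->
  two_types (false, true, false) n d <->
  supported (fun i j => (i.+2 == n) && (j.+1 == n)) n d.
Proof.
move=> n3; split=> [D | [b D] i j k ij jk]; last first.
  rewrite !D //; last lia.
  by case: b {D} => //=; have := ltn_ord k; rewrite !xpair_eqE; lia.
have h1 : (n.-1 < n)%N by lia. have h2 : (n.-2 < n)%N by lia.
exists (d (Ordinal h2) (Ordinal h1)) => i j ij.
have ltj := ltn_ord j.
case: (altP (j.+1 =P n)) => ej; last first.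
  have jk : (j < Ordinal h1)%N by rewrite /=; lia.
  by have := D i j _ ij jk; rewrite andbF andbF; case: (d i j).
have -> : j = Ordinal h1 by apply: val_inj => /=; lia.
case: (altP (i.+2 =P n)) => ei; rewrite /= ?andbT ?andbF.
  by congr d; apply: val_inj => /=; lia.
have ik : (i < Ordinal h2)%N by rewrite /=; lia.
have kj : (Ordinal h2 < Ordinal h1)%N by rewrite /=; lia.
by have := D i _ _ ik kj; case: (d i (Ordinal h1)); rewrite !xpair_eqE /= ?andbF.
Qed.

(** Symmetrically, no position lies before or inside a related pair, so it consists of the first
    two; [j == 1] says so because [i < j]. *)
Lemma two_types213 n (d : 'I_n -> 'I_n -> bool) : (2 < n)%N ->
  two_types (true, false, false) n d <->
  supported (fun i j => j == 1%N) n d.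
Proof.
move=> n3; split=> [D | [b D] i j k ij jk]; last first.
  rewrite !D //; last lia.
  by case: b {D} => //=; rewrite !xpair_eqE; lia.
have h0 : (0 < n)%N by lia. have h1 : (1 < n)%N by lia.
exists (d (Ordinal h0) (Ordinal h1)) => i j ij.
case: (altP (nat_of_ord j =P 1%N)) => ej; rewrite ?andbT ?andbF.
  by congr d; apply: val_inj => /=; lia.
case: (posnP i) => i0.
  have ik : (i < Ordinal h1)%N by rewrite /=; lia.
  have kj : (Ordinal h1 < j)%N by rewrite /=; lia.
  by have := D i _ _ ik kj; case: (d i j); rewrite !xpair_eqE /= ?andbF.
have ki : (Ordinal h0 < i)%N by [].
by have := D _ _ _ ki ij; case: (d i j); rewrite !xpair_eqE /= ?andbF.
Qed.

(** A related pair ends at the last position, and there equality of the second and third entries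
    makes the value independent of [i]. *)
Lemma two_types231 n (d : 'I_n -> 'I_n -> bool) : (2 < n)%N ->
  two_types (false, true, true) n d <->
  supported (fun i j => j.+1 == n) n d.
Proof.
move=> n3; split=> [D | [b D] i j k ij jk]; last first.
  rewrite !D //; last lia.
  by case: b {D} => //=; have := ltn_ord k; rewrite !xpair_eqE; lia.
have h0 : (0 < n)%N by lia. have h1 : (n.-1 < n)%N by lia.
exists (d (Ordinal h0) (Ordinal h1)) => i j ij.
have ltj := ltn_ord j.
case: (altP (j.+1 =P n)) => ej; rewrite ?andbT ?andbF; last first.
  have jk : (j < Ordinal h1)%N by rewrite /=; lia.
  by have := D i j _ ij jk; case: (d i j).
have -> : j = Ordinal h1 by apply: val_inj => /=; lia.
case: (posnP i) => i0; first by congr d; apply: val_inj.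
have ki : (Ordinal h0 < i)%N by [].
have ik : (i < Ordinal h1)%N by rewrite /=; lia.
have := D _ _ _ ki ik; rewrite !xpair_eqE.
by case: (d i _); case: (d (Ordinal h0) (Ordinal h1)); rewrite /= ?andbF.
Qed.

(** A related pair starts at position 0, and there equality of the first and third entries makes the
    value independent of [j]. *)
Lemma two_types312 n (d : 'I_n -> 'I_n -> bool) : (2 < n)%N ->
  two_types (true, false, true) n d <->
  supported (fun i j => i == 0%N) n d.
Proof.
move=> n3; split=> [D | [b D] i j k ij jk]; last first.
  rewrite !D //; last lia.
  by case: b {D} => //=; rewrite !xpair_eqE; lia.
have h0 : (0 < n)%N by lia. have h1 : (n.-1 < n)%N by lia.
exists (d (Ordinal h0) (Ordinal h1)) => i j ij.
have ltj := ltn_ord j.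
case: (posnP i) => i0; rewrite ?andbT ?andbF; last first.
  have ki : (Ordinal h0 < i)%N by [].
  by have := D _ _ _ ki ij; rewrite !xpair_eqE; case: (d i j); rewrite /= ?andbF.
have -> : i = Ordinal h0 by apply: val_inj.
case: (altP (j.+1 =P n)) => ej; first by congr d; apply: val_inj => /=; lia.
have kj : (Ordinal h0 < j)%N by rewrite /= -i0.
have jk : (j < Ordinal h1)%N by rewrite /=; lia.
have := D _ _ _ kj jk; rewrite !xpair_eqE.
by case: (d _ j); case: (d (Ordinal h0) (Ordinal h1)); rewrite /= ?andbF.
Qed.

Lemma two_types321 n (d : 'I_n -> 'I_n -> bool) : (2 < n)%N ->
  two_types (true, true, true) n d <-> supported (fun i j => true) n d.
Proof.
move=> n3; split=> [D | [b D] i j k ij jk]; last first.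
  by rewrite !D ?(ltn_trans ij jk) //; case: b {D}.
have h0 : (0 < n)%N by lia. have h1 : (n.-1 < n)%N by lia.
exists (d (Ordinal h0) (Ordinal h1)) => i j ij; rewrite andbT.
have ltj := ltn_ord j.
(* The entries of a triple agree, so each pair can be compared with the pair of extreme
   positions. *)
have E (x y z : 'I_n) : (x < y)%N -> (y < z)%N -> d x y = d x z /\ d y z = d x z.
  by move=> xy yz; have := D x y z xy yz;
    case: (d x y); case: (d x z); case: (d y z).
have -> : d i j = d (Ordinal h0) j.
  case: (posnP i) => i0; first by congr d; apply: val_inj.
  have ki : (Ordinal h0 < i)%N by [].
  by have [] := E _ _ _ ki ij.
case: (altP (j.+1 =P n)) => ej; first by congr d; apply: val_inj => /=; lia.
have kj : (Ordinal h0 < j)%N by rewrite /=; lia.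
have jk : (j < Ordinal h1)%N by rewrite /=; lia.
by have [] := E _ _ _ kj jk.
Qed.

Lemma two_types123 n (d : 'I_n -> 'I_n -> bool) : (2 < n)%N ->
  two_types (false, false, false) n d <-> supported (fun i j => false) n d.
Proof.
move=> n3; split=> [D | [b D] i j k ij jk]; last first.
  by rewrite !D ?(ltn_trans ij jk) ?andbF.
have h0 : (0 < n)%N by lia. have h1 : (n.-1 < n)%N by lia.
exists false => i j ij; have ltj := ltn_ord j.
case: (posnP i) => i0; last first.
  have ki : (Ordinal h0 < i)%N by [].
  by have := D _ _ _ ki ij; rewrite !xpair_eqE; case: (d i j); rewrite /= ?andbF.
case: (altP (j.+1 =P n)) => ej.
  (* The pair of extreme positions extends to a triple only through a middle position; 1 serves. *)
  have h2 : (1 < n)%N by lia.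
  have ik : (i < Ordinal h2)%N by rewrite /=; lia.
  have kj : (Ordinal h2 < j)%N by rewrite /=; lia.
  by have := D _ _ _ ik kj; rewrite !xpair_eqE; case: (d i j); rewrite /= ?andbF.
have jk : (j < Ordinal h1)%N by rewrite /=; lia.
by have := D _ _ _ ij jk; rewrite !xpair_eqE; case: (d i j); rewrite /= ?andbF.
Qed.

(** * The cyclic shift, the reversal and the end transpositions *)

(** In one-line notation, [2 3 ... n 1]. *)
Definition shiftp n : 'S_n := perm (@ordS_inj n).

Lemma shiftpE n (i : 'I_n) :
  shiftp n i = (if i.+1 == n then 0 else i.+1)%N :> nat.
Proof.
rewrite permE /=; have := ltn_ord i; case: eqP => [->|ne lt]; first by rewrite modnn.
by rewrite modn_small // ltn_neqAle lt andbT; apply/eqP.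
Qed.

Lemma shiftpVE n (i : 'I_n) :
  (shiftp n)^-1 i = (if i == 0 :> nat then n.-1 else i.-1)%N :> nat.
Proof.
have := shiftpE n ((shiftp n)^-1 i); rewrite permKV.
have := ltn_ord ((shiftp n)^-1 i); case: eqP; case: eqP; lia.
Qed.

Lemma revpE n (i : 'I_n) : revp n i = (n - i.+1)%N :> nat.
Proof. by rewrite permE. Qed.

Lemma revp_sqr n : revp n ^+ 2 = 1.
Proof. by apply/permP => i; rewrite expgS expg1 permM !permE rev_ordK. Qed.

Lemma order_revp n : (1 < n)%N -> #[revp n] = 2%N.
Proof.
move=> n1; apply: nt_prime_order => //; first exact: revp_sqr.
apply/eqP => /permP/(_ (Ordinal (ltnW n1))); rewrite perm1 => /(congr1 val) /=.
by rewrite revpE /=; lia.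
Qed.

Lemma revpV n : (revp n)^-1 = revp n.
Proof. by apply/eqP; rewrite eq_invg_mul -expg2 revp_sqr. Qed.

Lemma shiftp_revp n : shiftp n ^ revp n = (shiftp n)^-1.
Proof.
apply/permP => i; apply: val_inj => /=.
rewrite conjgE revpV !permM shiftpVE revpE shiftpE revpE.
have := ltn_ord i; case: eqP; case: eqP; lia.
Qed.

Lemma order_shiftp n : (0 < n)%N -> #[shiftp n] = n.
Proof.
move=> n0.
(* The orbit of 0 decides the order: every point is the image of 0 under a power of the shift. *)
have E k : ((shiftp n ^+ k) (Ordinal n0) = k %% n :> nat)%N.
  elim: k => [|k IH]; first by rewrite perm1 mod0n.
  by rewrite expgSr permM permE /= IH -addn1 modnDml addn1.
apply/eqP; rewrite eqn_dvd; apply/andP; split; last first.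
  by have := E #[shiftp n]; rewrite expg_order perm1 /dvdn => /= <-.
rewrite order_dvdn; apply/eqP/permP => i; rewrite perm1.
have -> : i = (shiftp n ^+ i) (Ordinal n0).
  by apply: val_inj; rewrite /= E modn_small.
rewrite -permM -expgD addnC; apply: val_inj; rewrite /= !E.
by rewrite modnDl.
Qed.

Definition swap_last m : 'S_m.+3 := tperm (inord m.+1) ord_max.

Definition swap_first m : 'S_m.+3 := tperm ord0 (inord 1%N).

Lemma swap_last_revp m : swap_last m ^ revp m.+3 = swap_first m.
Proof.
rewrite tpermJ tpermC; congr tperm; apply: val_inj => /=;
  rewrite revpE /= ?inordK //; lia.
Qed.

Lemma val_tperm n (x y z : 'I_n) :
  tperm x y z =
    (if z == x :> nat then y : nat else if z == y :> nat then x : nat else z)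
    :> nat.
Proof.
case: tpermP => [->|->|/eqP/negPf a /eqP/negPf b]; rewrite ?eqxx //.
  by case: ifP => // /eqP ->.
by rewrite !val_eqE a b.
Qed.

Lemma swap_last_inversions m (i j : 'I_m.+3) : (i < j)%N ->
  (swap_last m j < swap_last m i)%N = (i.+2 == m.+3) && (j.+1 == m.+3).
Proof.
move=> ij; have := ltn_ord j.
by rewrite !val_tperm /= !inordK //; do !case: eqP => /=; lia.
Qed.

Lemma swap_first_inversions m (i j : 'I_m.+3) : (i < j)%N ->
  (swap_first m j < swap_first m i)%N = (j == 1%N :> nat).
Proof.
move=> ij; rewrite !val_tperm /= !inordK //; do !case: eqP => /=; lia.
Qed.

Lemma shiftp_inversions n (i j : 'I_n) : (i < j)%N ->
  (shiftp n j < shiftp n i)%N = (j.+1 == n).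
Proof.
move=> ij; have := ltn_ord j; rewrite !shiftpE; do !case: eqP => /=; lia.
Qed.

Lemma shiftpV_inversions n (i j : 'I_n) : (i < j)%N ->
  ((shiftp n)^-1%g j < (shiftp n)^-1%g i)%N = (i == 0%N :> nat).
Proof.
move=> ij; have := ltn_ord j; rewrite !shiftpVE; do !case: eqP => /=; lia.
Qed.

Lemma revp_inversions n (i j : 'I_n) : (i < j)%N -> (revp n j < revp n i)%N = true.
Proof. by move=> ij; have := ltn_ord j; rewrite !revpE; lia. Qed.

Lemma perm1_inversions n (i j : 'I_n) : (i < j)%N ->
  ((1%g : 'S_n) j < (1%g : 'S_n) i)%N = false.
Proof. by rewrite !perm1; lia. Qed.

(** * Groups generated by one or two elements *)

(** Distinct involutions generate a dihedral group; its order comes from the factorization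
    [<[x * y]> * <[x]>] with trivial intersection. *)
Lemma dihedral_gen2 (gT : finGroupType) (x y : gT) :
  #[x] = 2%N -> #[y] = 2%N -> (2 < #[(x * y)%g])%N ->
  <<[set x; y]%SET>> \isog 'D_(#[x * y].*2).
Proof.
move=> ox oy oz.
have invE (u : gT) : #[u] = 2%N -> u^-1 = u.
  by move=> ou; apply/eqP; rewrite eq_invg_mul -expg2 -ou expg_order.
have zx : (x * y) ^ x = (x * y)^-1.
  by rewrite invMg (invE _ ox) (invE _ oy) conjgE (invE _ ox) !mulgA -expg2
    -{1}ox expg_order mul1g.
have nz : <[x]> \subset 'N(<[x * y]>).
  by rewrite cycle_subG; apply/normP; rewrite -cycleJ zx cycleV.
have tri : <[x * y]> :&: <[x]> = 1.
  rewrite finset.setIC; apply: prime_TIg; first by rewrite -orderE ox.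
  (* If [x] were a power of [x * y], it would commute with [x * y] while inverting it, so [x * y]
     would have order at most 2. *)
  rewrite cycle_subG; apply/negP => /cycleP[k xk].
  have := zx; rewrite {2}xk conjgE commuteX // mulKg => /esym/eqP.
  rewrite eq_invg_mul -expg2 -order_dvdn => /dvdn_leq.
  by move=> /(_ isT); lia.
have xy : x != y.
  by apply: contraTneq oz => ->; rewrite -{2}(invE _ oy) mulgV order1.
have -> : (#[x * y].*2 = #|<<[set x; y]%SET>>|)%N.
  have -> : <<[set x; y]%SET>> = <[x * y]> * <[x]>.
    rewrite -norm_joinEr //; apply/eqP; rewrite finset.eqEsubset.
    apply/andP; split.
      rewrite gen_subG finset.subUset !finset.sub1set.
      have xJ : x \in <[x * y]> <*> <[x]> by rewrite mem_gen // inE cycle_id orbT.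
      rewrite xJ -[y in y \in _](mulKg x) groupM ?groupV //.
      by rewrite mem_gen // inE cycle_id.
    have xG : x \in <<[set x; y]%SET>> by rewrite mem_gen ?finset.set21.
    by rewrite join_subG !cycle_subG groupM // mem_gen ?finset.set22.
  by rewrite TI_cardMg // -!orderE ox muln2.
exact: involutions_gen_dihedral.
Qed.

Lemma gen_set2M (gT : finGroupType) (x y : gT) :
  <<[set x; y * x]%SET>> = <<[set x; y]%SET>>.
Proof.
have mem (u v : gT) : u \in <<[set u; v]%SET>> /\ v \in <<[set u; v]%SET>>.
  by rewrite !mem_gen ?finset.set21 ?finset.set22.
have [xy yy] := mem x y; have [xx yx] := mem x (y * x).
apply/eqP; rewrite finset.eqEsubset !gen_subG !finset.subUset !finset.sub1set.
by rewrite xy xx groupM // -(groupMr y xx).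
Qed.

Lemma gen_set1x (gT : finGroupType) (x : gT) : <<[set 1; x]%SET>> = <[x]>.
Proof.
apply/eqP; rewrite finset.eqEsubset gen_subG finset.subUset !finset.sub1set.
by rewrite group1 cycle_id /= cycle_subG mem_gen ?finset.set22.
Qed.

Lemma cycle_isog_Zp (gT : finGroupType) (x : gT) n :
  (1 < n)%N -> #[x] = n -> <[x]> \isog Zp n.
Proof.
move=> n1 ox; rewrite isog_cyclic_card ?cycle_cyclic //.
rewrite card_Zp -?orderE ?ox ?eqxx ?andbT; last exact: ltnW.
rewrite /= /Zp n1; apply/cyclicP; exists Zp1.
by case: n n1 {ox} => [|[|n]] // _; exact: Zp_cycle.
Qed.

(** * Explicit sets of avoiders *)

Lemma Av_monotone3_set0 n (T' : set permutation) : (4 < n)%N ->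
  Av n ([set p123; p321] `|` T')%classic = finset.set0.
Proof.
move=> n4; apply/setP => p; rewrite finset.in_set0 !Av_setU !Av_patterns.
rewrite avoidersI; apply/negP; rewrite finset.in_setI => /andP[/avoidersP av _].
have alt (i j k : 'I_n) : (i < j)%N -> (j < k)%N ->
    (p k < p j)%N = ~~ (p j < p i)%N.
  move=> ij jk; have := av i j k ij jk; have := inversions_patterns3 n p i j k ij jk.
  rewrite /inversions !inE !xpair_eqE.
  by case: (p j < p i)%N; case: (p k < p j)%N; case: (p k < p i)%N.
pose x k (h : (k < 5)%N) : 'I_n := Ordinal (leq_trans h n4).
(* Let [a] be the inversion bit of positions 0 and 1. The bit of 3 and 4 is [a] by way of the pair
   1, 3, but [~~ a] by way of the pairs 1, 2 and 2, 3. *)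
have e12 := alt (x 0%N isT) (x 1%N isT) (x 2%N isT) isT isT.
have e13 := alt (x 0%N isT) (x 1%N isT) (x 3%N isT) isT isT.
have e23 := alt (x 1%N isT) (x 2%N isT) (x 3%N isT) isT isT.
have e34 := alt (x 1%N isT) (x 3%N isT) (x 4%N isT) isT isT.
have := alt (x 2%N isT) (x 3%N isT) (x 4%N isT) isT isT.
by rewrite e34 e13 e23 e12; case: (_ < _)%N.
Qed.

Lemma avoiders_allowing132 m ts (e : bool) :
  allowed_up_to_flip ts e (false, true, false) ->
  avoiders m.+3 ts = [set revp m.+3 ^+ e; swap_last m * revp m.+3 ^+ e]%SET.
Proof.
move=> tsP; apply: avoiders_pair tsP _ (@swap_last_inversions _) => d.
exact: two_types132.
Qed.

Lemma avoiders_allowing213 m ts (e : bool) :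
  allowed_up_to_flip ts e (true, false, false) ->
  avoiders m.+3 ts = [set revp m.+3 ^+ e; swap_first m * revp m.+3 ^+ e]%SET.
Proof.
move=> tsP; apply: avoiders_pair tsP _ (@swap_first_inversions _) => d.
exact: two_types213.
Qed.

Lemma avoiders_allowing231 n ts (e : bool) : (2 < n)%N ->
  allowed_up_to_flip ts e (false, true, true) ->
  avoiders n ts = [set revp n ^+ e; shiftp n * revp n ^+ e]%SET.
Proof.
move=> n3 tsP; apply: avoiders_pair tsP _ (@shiftp_inversions _) => d.
exact: two_types231.
Qed.

Lemma avoiders_allowing312 n ts (e : bool) : (2 < n)%N ->
  allowed_up_to_flip ts e (true, false, true) ->
  avoiders n ts = [set revp n ^+ e; (shiftp n)^-1 * revp n ^+ e]%SET.
Proof.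
move=> n3 tsP; apply: avoiders_pair tsP _ (@shiftpV_inversions _) => d.
exact: two_types312.
Qed.

Lemma avoiders_allowing321 n ts (e : bool) : (2 < n)%N ->
  allowed_up_to_flip ts e (true, true, true) ->
  avoiders n ts = [set revp n ^+ e; revp n * revp n ^+ e]%SET.
Proof.
move=> n3 tsP; apply: avoiders_pair tsP _ (@revp_inversions _) => d.
exact: two_types321.
Qed.

Lemma avoiders_allowing123 n ts (e : bool) : (2 < n)%N ->
  allowed_up_to_flip ts e (false, false, false) ->
  avoiders n ts = [set revp n ^+ e; 1 * revp n ^+ e]%SET.
Proof.
move=> n3 tsP; apply: avoiders_pair tsP _ (@perm1_inversions _) => d.
exact: two_types123.
Qed.

(** * Orders of the end transpositions and of a product with the reversal *)

Lemma order_swap_last m : #[swap_last m] = 2%N.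
Proof.
apply: nt_prime_order => //; first by rewrite expg2 tperm2.
apply/eqP => /permP/(_ ord_max); rewrite perm1 tpermR => /(congr1 val) /=.
by rewrite inordK //; lia.
Qed.

Lemma order_swap_first m : #[swap_first m] = 2%N.
Proof. by rewrite -swap_last_revp orderJ order_swap_last. Qed.

(** The square is the product of the two end transpositions, which are disjoint when [0 < m] and so
    give an involution. *)
Lemma order_revp_swap_last m : (0 < m)%N -> #[revp m.+3 * swap_last m] = 4%N.
Proof.
move=> m0; set w := revp _; set t := swap_last m.
have sqr : (w * t) ^+ 2 = swap_first m * t.
  by rewrite expg2 -swap_last_revp conjgE revpV !mulgA.
have : #[w * t] %| 4.
  have c : commute (swap_first m) t.
    apply/permP => i; apply: val_inj; rewrite /= !permM !val_tperm /= !inordK //.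
    do !case: eqP => /=; lia.
  rewrite order_dvdn (expgM _ 2 2) sqr expgMn //.
  by rewrite -{1}(order_swap_first m) -(order_swap_last m) !expg_order mulg1.
have : ~~ (#[w * t] %| 2).
  rewrite order_dvdn sqr; apply/eqP => /permP/(_ ord0) /(congr1 val) /=.
  by rewrite permM !val_tperm perm1 /= !inordK //; do !case: eqP => /=; lia.
move=> n2 d4; have := @dvdn_leq _ 4 isT d4; move: n2 d4.
by case: #[_] => [|[|[|[|[|k]]]]].
Qed.

(** * Identification of the generated groups *)

Theorem theorem8p1 :
  (* (1) *)
  (forall (T' : set permutation) (n : nat), (4 < n)%N ->
     <<Av n ([set p123; p321] `|` T')%classic>> = [set 1]%SET) /\
  (* (2) *)
  (exists N : nat, forall n : nat, (N <= n)%N ->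
     [/\ <<Av n [set p213; p231; p312; p321]>>
           \isog <<Av n [set p132; p231; p312; p321]>>,
         <<Av n [set p132; p231; p312; p321]>>
           \isog <<Av n [set p132; p213; p231; p312]>>
       & <<Av n [set p132; p213; p231; p312]>> \isog Zp 2]) /\
  (* (3) *)
  (exists N : nat, forall n : nat, (N <= n)%N ->
     <<Av n [set p123; p132; p213; p231]>>
       \isog <<Av n [set p123; p132; p213; p312]>> /\
     <<Av n [set p123; p132; p213; p312]>> \isog 'D_(4.*2)) /\
  (* (4) *)
  (exists N : nat, forall n : nat, (N <= n)%N ->
     <<Av n [set p132; p213; p312; p321]>>
       \isog <<Av n [set p132; p213; p231; p321]>> /\
     <<Av n [set p132; p213; p231; p321]>> \isog Zp n) /\
  (* (5); in MathComp 'D_m is the dihedral group of order m *)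
  (exists N : nat, forall n : nat, (N <= n)%N ->
     <<Av n [set p123; p213; p231; p312]>>
       \isog <<Av n [set p123; p132; p231; p312]>> /\
     <<Av n [set p123; p132; p231; p312]>> \isog 'D_(n.*2)) /\
  (* (6) *)
  (exists N : nat, forall n : nat, (N <= n)%N ->
     <<Av n [set p123; p132; p213; p231; p312]>> \isog Zp 2) /\
  (* (7) *)
  (exists N : nat, forall n : nat, (N <= n)%N ->
     <<Av n [set p132; p213; p231; p312; p321]>> = [set 1]%SET).
Proof.
have cyc2 k (x : 'S_k) : #[x] = 2%N -> <<[set 1; x]%SET>> \isog Zp 2.
  by move=> ox; rewrite gen_set1x; apply: cycle_isog_Zp.
have big n : (4 <= n)%N -> exists2 m, (0 < m)%N & n = m.+3.
  by case: n => [|[|[|n]]] // n4; exists n.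
have via (k l : nat) (G : {group 'S_k}) (H : {group 'S_l}) (rT : finGroupType)
    (K : {group rT}) : G \isog K -> H \isog K -> G \isog H.
  by move=> GK HK; apply: isog_trans GK _; rewrite isog_sym.
(* There is no avoider, and the empty set generates the trivial group. *)
split=> [T' n n4|]; first by rewrite Av_monotone3_set0 // gen0.
do !split; exists 4%N => n /[dup] n4 /big[m m0 nE];
  rewrite !Av_setU !Av_patterns !avoidersI.
- subst n.
  rewrite (avoiders_allowing132 _ _ false) // (avoiders_allowing213 _ _ false) //.
  rewrite (avoiders_allowing321 _ _ false) // !mulg1.
  have [[a b] c] := (cyc2 _ _ (order_swap_last m), cyc2 _ _ (order_swap_first m),
     cyc2 _ _ (order_revp m.+3 isT)).
  by split=> //; [apply: via a b | apply: via b c].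
- subst n.
  (* The allowed patterns are 321 with 312, then 321 with 231; their complements are 123 with 132,
     then 123 with 213. *)
  rewrite (avoiders_allowing132 _ _ true) // (avoiders_allowing213 _ _ true) //.
  have dih t : #[t] = 2%N -> #[revp m.+3 * t] = 4%N ->
      <<[set revp m.+3; t * revp m.+3]%SET>> \isog 'D_(4.*2).
    move=> t2 o4; rewrite -o4.
    have -> : <<[set revp m.+3; t * revp m.+3]%SET>> = <<[set revp m.+3; t]%SET>>.
      exact: gen_set2M.
    by apply: dihedral_gen2; rewrite ?order_revp ?o4.
  have a := dih _ (order_swap_last m) (order_revp_swap_last m m0).
  have b : <<[set revp m.+3; swap_first m * revp m.+3]%SET>> \isog 'D_(4.*2).
    apply: dih; first exact: order_swap_first.
    (* With [w] the reversal and [t] the last transposition, [w * t ^ w = t * w] is the inverse of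
       [w * t]. *)
    by rewrite -swap_last_revp conjgE mulKVg -orderV invMg revpV tpermV
      order_revp_swap_last.
  by split=> //; apply: via a b.
- have n2 : (2 < n)%N by rewrite ltnW.
  rewrite (avoiders_allowing231 _ _ false) // (avoiders_allowing312 _ _ false) //.
  rewrite !mulg1 !gen_set1x.
  have a : <[shiftp n]> \isog Zp n.
    by apply: cycle_isog_Zp; rewrite ?order_shiftp //; lia.
  have b : <[(shiftp n)^-1]> \isog Zp n by rewrite cycleV.
  by split=> //; apply: via a b.
- have n2 : (2 < n)%N by rewrite ltnW.
  (* The patterns 132 and 213, each allowed along with 321, have complements 312 and 231. *)
  rewrite (avoiders_allowing312 _ _ true) // (avoiders_allowing231 _ _ true) //.
  have inv q : #[q] = n -> q ^ revp n = q^-1 ->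
      <<[set revp n; q * revp n]%SET>> \isog 'D_(n.*2).
    move=> oq qJ.
    (* The product of the two generators is the conjugate of [q] by the reversal. *)
    have e : #[revp n * (q * revp n)] = n.
      by rewrite -{1}revpV -conjgE orderJ.
    have ow := order_revp n (ltnW n2).
    suff oqw : #[q * revp n] = 2%N.
      by have := dihedral_gen2 _ _ _ ow oqw; rewrite e => /(_ n2).
    apply: nt_prime_order => //.
      by rewrite expg2 -mulgA -{1}revpV -conjgE qJ mulgV.
    (* A trivial [q * revp n] would make [n] the order of the reversal, which is 2. *)
    apply/eqP => q1; have := e; rewrite q1 mulg1 ow => nn.
    by rewrite -nn in n2.
  have a := inv _ (order_shiftp n (ltn_trans (ltn0Sn 1) n2)) (shiftp_revp n).
  have b : <<[set revp n; (shiftp n)^-1 * revp n]%SET>> \isog 'D_(n.*2).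
    by apply: inv; rewrite ?orderV ?order_shiftp ?conjVg ?shiftp_revp //; lia.
  by split=> //; apply: via b a.
- have n2 : (2 < n)%N by rewrite ltnW.
  (* Only 321 is allowed, so both listed avoiders are the reversal. *)
  rewrite (avoiders_allowing123 _ _ true) // mul1g finset.setUid.
  by apply: cycle_isog_Zp; rewrite ?order_revp // ltnW.
have n2 : (2 < n)%N by rewrite ltnW.
rewrite (avoiders_allowing123 _ _ false) // mul1g finset.setUid.
exact: cycle1.
Qed.
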